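(* Let $f$ be a deterministic voting rule whose utilitarian distortion on instances with $m$ alternatives is $o(m^2\sqrt m)$ as $m\to\infty$. Then for all sufficiently large $m$, the metric distortion of $f$ on instances with $m$ alternatives is strictly greater than $3$.
   Context: Setting: $n$ agents, $m$ alternatives, each agent has a strict ranking; a deterministic voting rule maps each profile to one alternative. Metric framework: pseudometric $d$ on agents and alternatives, consistent with profile $\vec\sigma$ if $X\succ_iY\Rightarrow d(i,X)\le d(i,Y)$; $\mathrm{SC}(X,d)=\sum_id(i,X)$; the metric distortion of $f$ (for given $m$) is $\sup$ over profiles with $m$ alternatives and consistent $d$ of $\mathrm{SC}(f(\vec\sigma),d)/\min_X\mathrm{SC}(X,d)$. Utilitarian framework: unit-sum nonnegative utilities $u_i$ ($\sum_Xu_i(X)=1$), consistent if $X\succ_iY\Rightarrow u_i(X)\ge u_i(Y)$; $\mathrm{SW}(X,\vec u)=\sum_iu_i(X)$; the utilitarian distortion of $f$ (for given $m$) is $\sup$ over profiles with $m$ alternatives and consistent $\vec u$ of $\max_X\mathrm{SW}(X,\vec u)/\mathrm{SW}(f(\vec\sigma),\vec u)$. *)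

(* Defs.v *)
From HB Require Import structures.
From mathcomp Require Import all_boot all_order all_algebra all_fingroup.
From mathcomp Require Import all_classical all_reals ereal.
Set Implicit Arguments. Unset Strict Implicit. Unset Printing Implicit Defensive.
Import Order.TTheory GRing.Theory Num.Theory.
Local Open Scope ring_scope.

(* A profile with n agents and m alternatives: agent i's strict ranking is a
   permutation sigma i mapping each alternative to its position (0 = best);
   X is preferred to Y by i iff sigma i X < sigma i Y. *)
Definition profile (n m : nat) := 'I_n -> {perm 'I_m}.

Definition prefers n m (s : profile n m) (i : 'I_n) (X Y : 'I_m) : bool :=
  (s i X < s i Y)%N.

Definition voting_rule := forall n m : nat, profile n m.+1 -> 'I_m.+1.

Definition ratio (R : realType) (a b : R) : \bar R :=
  if b == 0 then (if a == 0 then 1%E else +oo%E) else (a / b)%:E.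

Definition pseudometric (T : Type) (R : realType) (d : T -> T -> R) : Prop :=
  (forall x y, 0 <= d x y) /\ (forall x, d x x = 0) /\
  (forall x y, d x y = d y x) /\ (forall x y z, d x z <= d x y + d y z).

Definition metric_consistent (R : realType) n m (s : profile n m)
  (d : 'I_n + 'I_m -> 'I_n + 'I_m -> R) : Prop :=
  forall i X Y, prefers s i X Y -> d (inl i) (inr X) <= d (inl i) (inr Y).

Definition SC (R : realType) n m (d : 'I_n + 'I_m -> 'I_n + 'I_m -> R)
  (X : 'I_m) : R := \sum_(i < n) d (inl i) (inr X).

Definition minSC (R : realType) n m (d : 'I_n + 'I_m.+1 -> 'I_n + 'I_m.+1 -> R)
  : R := \big[Num.min/SC d ord0]_(X < m.+1) SC d X.

Definition metric_distortion_S (R : realType) (f : voting_rule) (m : nat)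
  : \bar R :=
  ereal_sup [set r : \bar R | exists n (s : profile n m.+1)
     (d : 'I_n + 'I_m.+1 -> 'I_n + 'I_m.+1 -> R),
     pseudometric d /\ metric_consistent s d /\
     r = ratio (SC d (f n m s)) (minSC d)].

Definition utility_consistent (R : realType) n m (s : profile n m)
  (u : 'I_n -> 'I_m -> R) : Prop :=
  (forall i X, 0 <= u i X) /\ (forall i, \sum_(X < m) u i X = 1) /\
  (forall i X Y, prefers s i X Y -> u i Y <= u i X).

Definition SW (R : realType) n m (u : 'I_n -> 'I_m -> R) (X : 'I_m) : R :=
  \sum_(i < n) u i X.

Definition maxSW (R : realType) n m (u : 'I_n -> 'I_m.+1 -> R) : R :=
  \big[Num.max/SW u ord0]_(X < m.+1) SW u X.

Definition utilitarian_distortion_S (R : realType) (f : voting_rule) (m : nat)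
  : \bar R :=
  ereal_sup [set r : \bar R | exists n (s : profile n m.+1)
     (u : 'I_n -> 'I_m.+1 -> R),
     utility_consistent s u /\
     r = ratio (maxSW u) (SW u (f n m s))].

(* Distortions indexed by the number m of alternatives (m = 0 is vacuous:
   there are no instances; we set the value to 0, irrelevant for
   asymptotic statements). *)
Definition metric_distortion (R : realType) (f : voting_rule) (m : nat) : \bar R :=
  if m is k.+1 then metric_distortion_S R f k else 0%E.
Definition utilitarian_distortion (R : realType) (f : voting_rule) (m : nat)
  : \bar R :=
  if m is k.+1 then utilitarian_distortion_S R f k else 0%E.

(* Main.v *)
Require Import Defs.
From mathcomp Require Import all_boot all_order all_algebra all_fingroup.
From mathcomp Require Import all_classical all_reals ereal.
From mathcomp Require Import zify ring lra.
Import Order.TTheory GRing.Theory Num.Theory.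
Local Open Scope ring_scope.

(** Alternatives are split into 0, a group [low] of size c + 1 and a group
    [high] of size q, with c and q about m / 2.  Each low alternative is ranked
    first by one voter and each high one by c voters; every voter ranks the
    remaining alternatives in the order 0, low, high.

    If a high alternative wins, put 0 and the low alternatives, with their
    voters, at the centre of a star, each high alternative at distance 2 on its
    own ray, and its voters halfway.  The winner then costs 3 q c + 2, while 0
    costs q c, because the c + 1 voters at the centre outnumber the c supporters
    of the winner.

    If a low alternative wins, it is worth only 1 / m to its unique supporter and
    nothing to the others, whereas every other voter can give 1 / 2 to 0, so the
    utilitarian distortion is at least q c m / 2, of order m ^ 3.  If 0 wins, it
    may be worthless to everybody. *)

(** The product form also covers [b = 0]: then [a] is positive and the ratio is infinite. *)
Lemma lt_ratio (R : realType) (C a b : R) :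
  0 <= b -> C * b < a -> (C%:E < Defs.ratio a b)%E.
Proof.
rewrite /Defs.ratio le_eqVlt => /predU1P[<-|b_gt0].
  by rewrite mulr0 eqxx => a_gt0; rewrite gt_eqF // ltry.
by rewrite gt_eqF // lte_fin ltr_pdivlMr.
Qed.

Lemma lt_metric_distortion_S (R : realType) (f : voting_rule) (n m : nat)
    (s : profile n m.+1) (d : 'I_n + 'I_m.+1 -> 'I_n + 'I_m.+1 -> R)
    (X : 'I_m.+1) (C : R) :
  pseudometric d -> metric_consistent s d -> 0 <= C ->
  C * SC d X < SC d (f n m s) -> (C%:E < metric_distortion_S R f m)%E.
Proof.
move=> d_pm d_s C_ge0 C_lt.
have SC_ge0 Y : 0 <= SC d Y by apply: sumr_ge0 => i _; apply: d_pm.1.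
apply: (@lt_le_trans _ _ (Defs.ratio (SC d (f n m s)) (minSC d))); last first.
  by apply: ereal_sup_ubound; exists n, s, d.
apply: lt_ratio; first exact: le_bigmin.
by apply: le_lt_trans C_lt; apply: ler_wpM2l => //; apply: bigmin_le.
Qed.

Lemma lt_utilitarian_distortion_S (R : realType) (f : voting_rule) (n m : nat)
    (s : profile n m.+1) (u : 'I_n -> 'I_m.+1 -> R) (X : 'I_m.+1) (C : R) :
  utility_consistent s u ->
  C * SW u (f n m s) < SW u X -> (C%:E < utilitarian_distortion_S R f m)%E.
Proof.
move=> u_s C_lt.
apply: (@lt_le_trans _ _ (Defs.ratio (maxSW u) (SW u (f n m s)))); last first.
  by apply: ereal_sup_ubound; exists n, s, u.
apply: lt_ratio; first by apply: sumr_ge0 => i _; apply: u_s.1.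
exact: lt_le_trans C_lt (le_bigmax _ _ _).
Qed.

(** Rays glued at a common centre, with [rad] the distance to it; points of radius 0 all coincide,
    whatever their ray. *)
Definition star_dist {R : realType} {T : Type} {L : eqType}
  (ray : T -> L) (rad : T -> R) (x y : T) : R :=
  if ray x == ray y then `|rad x - rad y| else rad x + rad y.

Lemma star_dist_pseudometric (R : realType) (T : Type) (L : eqType)
    (ray : T -> L) (rad : T -> R) :
  (forall x, 0 <= rad x) -> pseudometric (star_dist ray rad).
Proof.
move=> rad_ge0; rewrite /star_dist; split=> [x y|].
  by case: ifP => // _; apply: addr_ge0.
split=> [x|]; first by rewrite eqxx subrr normr0.
split=> [x y|x y z]; first by rewrite eq_sym distrC [rad y + rad x]addrC.
have := (rad_ge0 x, rad_ge0 y, rad_ge0 z) => -[[x0 y0] z0].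
case: (eqVneq (ray x) (ray y)) => [->|nxy].
  by case: ifP => _; do ?[case: ger0P => ?]; lra.
case: (eqVneq (ray y) (ray z)) => [<-|nyz].
  by rewrite (negbTE nxy); case: ger0P => ?; lra.
by case: ifP => _; do ?[case: ger0P => ?]; lra.
Qed.

(** [lift_perm] sends [t] to position 0 and keeps the other alternatives in increasing order. *)
Definition top_first {m : nat} (t : 'I_m.+1) : {perm 'I_m.+1} :=
  lift_perm t ord0 1.

Lemma top_firstP (m : nat) (t X Y : 'I_m.+1) :
  (top_first t X < top_first t Y)%N -> Y != t /\ (X = t \/ (X < Y)%N).
Proof.
rewrite /top_first; case: (unliftP t Y) => [y ->|->]; last first.
  by rewrite lift_perm_id.
split; first by rewrite eq_sym neq_lift.
case: (unliftP t X) H => [x ->|->]; last by left.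
by rewrite !lift_perm_lift !perm1 /= /bump; right; lia.
Qed.

(** [inl y] is the only supporter of the low alternative [y]; [inr (x, j)] is the [j]-th of the [c]
    supporters of the high alternative [x]. *)
Definition voter (c q : nat) : finType := ('I_c.+1 + 'I_q * 'I_c)%type.

Definition low {c : nat} (q : nat) (y : 'I_c.+1) : 'I_(c.+1 + q).+1 :=
  lift ord0 (lshift q y).

Definition high (c : nat) {q : nat} (x : 'I_q) : 'I_(c.+1 + q).+1 :=
  lift ord0 (rshift c.+1 x).

Definition top {c q : nat} (v : voter c q) : 'I_(c.+1 + q).+1 :=
  match v with inl y => low q y | inr (x, _) => high c x end.

Definition favourite {c q : nat} (i : 'I_#|voter c q|) := top (enum_val i).

Definition hard_profile (c q : nat) : profile #|voter c q| (c.+1 + q).+1 :=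
  fun i => top_first (favourite i).

(** Costs and utilities below depend on a voter only through the favourite, so every social cost or
    welfare is computed from this sum. *)
Lemma sum_favourite (V : nmodType) (c q : nat) (F : 'I_(c.+1 + q).+1 -> V) :
  \sum_(i < #|voter c q|) F (favourite i) =
  \sum_y F (low q y) + (\sum_x F (high c x)) *+ c.
Proof.
rewrite -(big_enum_val (fun v => F (top v))) /=.
transitivity (\sum_(v : voter c q) F (top v)); first exact: eq_bigl.
rewrite big_sumType /=.
congr (_ + _); rewrite -sumrMnl.
under [RHS]eq_bigr do rewrite -[X in _ *+ X]card_ord -sumr_const.
by rewrite pair_bigA; apply: eq_bigr => -[].
Qed.

Lemma favourite_neq0 (c q : nat) (i : 'I_#|voter c q|) : favourite i != ord0.
Proof. by rewrite /favourite; case: (enum_val i) => [y|[x j]]. Qed.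

Lemma low_inj (c q : nat) : injective (@low c q).
Proof. by move=> x y /lift_inj/lshift_inj. Qed.

Lemma high_inj (c q : nat) : injective (@high c q).
Proof. by move=> x y /lift_inj/rshift_inj. Qed.

Lemma low_neq_high (c q : nat) (y : 'I_c.+1) (x : 'I_q) : low q y != high c x.
Proof. by apply/eqP => /lift_inj/eqP; rewrite eq_lrshift. Qed.

Section HighWinner.
Variables (R : realType) (c q : nat).

(** Low alternatives have indices 1 to c + 1, so the test singles out the high ones. *)
Let alt_rad (X : 'I_(c.+1 + q).+1) : R := if (c.+1 < X)%N then 2 else 0.

Let ray (z : 'I_#|voter c q| + 'I_(c.+1 + q).+1) :=
  match z with inl i => favourite i | inr X => X end.

Let rad (z : 'I_#|voter c q| + 'I_(c.+1 + q).+1) : R :=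
  match z with inl i => alt_rad (favourite i) / 2 | inr X => alt_rad X end.

Let d := star_dist ray rad.

Let alt_rad_ge0 X : 0 <= alt_rad X.
Proof. by rewrite /alt_rad; case: ifP. Qed.

Let alt_rad_low y : alt_rad (low q y) = 0.
Proof. by rewrite /alt_rad ifF //= /bump /=; have := ltn_ord y; lia. Qed.

Let alt_rad_high x : alt_rad (high c x) = 2.
Proof. by rewrite /alt_rad ifT //= /bump /=; lia. Qed.

Let d_pseudometric : pseudometric d.
Proof.
apply: star_dist_pseudometric => -[i|X] //=.
by rewrite divr_ge0.
Qed.

Let d_consistent : metric_consistent (hard_profile c q) d.
Proof.
move=> i X Y /top_firstP[Yt Xt]; rewrite /d /star_dist /=.
set t := favourite i in Yt Xt *; rewrite [t == Y]eq_sym (negbTE Yt).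
have [t0 Y0] := (alt_rad_ge0 t, alt_rad_ge0 Y).
case: (eqVneq t X) => [<-|nX]; first by case: ger0P => ?; lra.
case: Xt nX => [->|ltXY _]; first by rewrite eqxx.
(* Neither [X] nor [Y] is on the voter's ray, so only their radii matter, and these grow with the
   index. *)
by rewrite lerD2l /alt_rad; case: ifP => // ltX; rewrite ifT //; lia.
Qed.

Let SC0 : SC d ord0 = (q * c)%:R.
Proof.
pose F t : R := if t == ord0 then `|alt_rad t / 2 - 0| else alt_rad t / 2 + 0.
transitivity (\sum_(i < #|voter c q|) F (favourite i)); first exact: eq_bigr.
rewrite sum_favourite (eq_bigr (fun=> 0)) => [|y _]; last first.
  by rewrite /F /= alt_rad_low; lra.
rewrite [X in _ + X *+ _](eq_bigr (fun=> 1)) => [|x _]; last first.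
  by rewrite /F /= alt_rad_high; lra.
by rewrite !sumr_const !card_ord mul0rn add0r -mulrnA.
Qed.

Let SC_high x : SC d (high c x) = 3 * (q * c)%:R + 2.
Proof.
pose F t : R := if t == high c x then `|alt_rad t / 2 - 2| else alt_rad t / 2 + 2.
transitivity (\sum_(i < #|voter c q|) F (favourite i)).
  by apply: eq_bigr => i _; rewrite /d /star_dist /= alt_rad_high.
(* Low voters pay 2, supporters of [x] pay 1 and other high voters 3: 2 (c + 1) + c (1 + 3 (q - 1))
   = 3 q c + 2. *)
rewrite sum_favourite (eq_bigr (fun=> 2)) => [|y _]; last first.
  by rewrite /F (negbTE (low_neq_high _ _ _ _)) alt_rad_low; lra.
rewrite (bigD1 x) //= [X in (_ + X) *+ _](eq_bigr (fun=> 3)) => [|z zx]; last first.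
  by rewrite /F (inj_eq (@high_inj c q)) (negbTE zx) alt_rad_high; lra.
rewrite /F eqxx alt_rad_high !sumr_const cardC1 !card_ord.
have q_gt0 : (0 < q)%N := leq_ltn_trans (leq0n x) (ltn_ord x).
have -> : `|2 / 2 - 2 : R| = 1 by case: ger0P; lra.
have -> : (q * c)%:R = (q.-1%:R + 1) * c%:R :> R by rewrite natrM natr1 prednK.
ring.
Qed.

Lemma high_winner_distortion (f : voting_rule) (x : 'I_q) :
  f _ _ (hard_profile c q) = high c x ->
  (3%:E < metric_distortion_S R f (c.+1 + q))%E.
Proof.
move=> fx; apply: (lt_metric_distortion_S _ _ _ _ (hard_profile c q) d ord0) => //.
by rewrite fx SC0 SC_high; lra.
Qed.

End HighWinner.

(** Nobody ranks 0 first, so if all voters put their whole utility on their favourite, 0 has welfare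
    0 and the ratio is infinite. *)
Lemma zero_winner_distortion (R : realType) (f : voting_rule) (c q : nat) (C : R) :
  f _ _ (hard_profile c q) = ord0 ->
  (C%:E < utilitarian_distortion_S R f (c.+1 + q))%E.
Proof.
move=> f0; pose u (i : 'I_#|voter c q|) X : R := (X == favourite i)%:R.
apply: (lt_utilitarian_distortion_S _ _ _ _ (hard_profile c q) u (low q ord0)).
  split=> [i X|]; first exact: ler0n.
  split=> [i|i X Y /top_firstP[/negbTE Yt _]]; last by rewrite /u Yt ler0n.
  rewrite /u (bigD1 (favourite i)) //= eqxx big1 ?addr0 // => X /negbTE ->.
  by [].
rewrite f0 /SW [\sum_(i < _) u i ord0]big1 => [|i _]; last first.
  by rewrite /u eq_sym (negbTE (favourite_neq0 _ _ _)).
rewrite mulr0 (sum_favourite _ _ _ (fun t => (low q ord0 == t)%:R)).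
rewrite (bigD1 ord0) //= -addrA.
apply: ltr_pwDl => //; apply: addr_ge0; first by apply: sumr_ge0.
by apply: mulrn_wge0; apply: sumr_ge0.
Qed.

Lemma low_winner_distortion (R : realType) (f : voting_rule) (c q : nat)
    (y : 'I_c.+1) (C : R) :
  f _ _ (hard_profile c q) = low q y -> C / (c.+1 + q).+1%:R < (q * c)%:R / 2 ->
  (C%:E < utilitarian_distortion_S R f (c.+1 + q))%E.
Proof.
move=> fy C_lt; set m := (c.+1 + q).+1 in C_lt *.
pose w (t X : 'I_m) : R :=
  if t == low q y then m%:R^-1 else ((X == t)%:R + (X == ord0)%:R) / 2.
pose u (i : 'I_#|voter c q|) X := w (favourite i) X.
have w_ge0 t X : 0 <= w t X.
  by rewrite /w; case: ifP => _; rewrite ?invr_ge0 ?divr_ge0 // addr_ge0.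
apply: (lt_utilitarian_distortion_S _ _ _ _ (hard_profile c q) u ord0).
  split=> [i X|]; first exact: w_ge0.
  split=> [i|i X Y /top_firstP[/negbTE Yt Xt]]; rewrite /u /w.
    case: (_ == low q y); first by rewrite sumr_const card_ord -[LHS]mulr_natr mulVf ?pnatr_eq0.
    rewrite -mulr_suml big_split /=.
    rewrite (bigD1 (favourite i)) //= eqxx big1 => [|X /negbTE ->] //.
    rewrite (bigD1 ord0) //= big1 => [|X /negbTE ->] //.
    by lra.
  case: ifP => // _; rewrite Yt.
  rewrite ler_pM2r ?invr_gt0 // add0r.
  case: Xt => [->|ltXY]; first by rewrite eqxx ler_wpDr // ler_nat leq_b1.
  (* [Y] comes after [X], so it is neither 0 nor the favourite and has utility 0. *)
  have -> : (Y == ord0) = false by apply/eqP => Y0; rewrite Y0 in ltXY.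
  exact: addr_ge0.
rewrite fy /SW (sum_favourite _ _ _ (w^~ (low q y))).
rewrite (sum_favourite _ _ _ (w^~ ord0)).
have wy0 z : z != y -> w (low q z) (low q y) = 0.
  move=> zy; rewrite /w (inj_eq (@low_inj c q)) (negbTE zy) eq_sym.
  by rewrite (inj_eq (@low_inj c q)) (negbTE zy) /=; lra.
have wh0 x : w (high c x) (low q y) = 0.
  rewrite /w [high c x == _]eq_sym (negbTE (low_neq_high _ _ _ _)) /=; lra.
have wh1 x : w (high c x) ord0 = 2^-1.
  rewrite /w [high c x == _]eq_sym (negbTE (low_neq_high _ _ _ _)) /=; lra.
rewrite (bigD1 y) //= big1 // (eq_bigr (fun=> 0)) // big1 // mul0rn !addr0.
rewrite [X in _ < _ + X *+ _](eq_bigr (fun=> 2^-1)) //.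
rewrite {1}/w eqxx sumr_const card_ord -mulrnA -(mulr_natl 2^-1).
(* The q c high voters already give 0 enough welfare; the low voters' share is dropped. *)
apply: lt_le_trans C_lt _; rewrite lerDr; exact: sumr_ge0.
Qed.

(** Since sqrt m <= m and m ^ 2 <= 16 q c, the left side is at most q c / 4, with q c positive. *)
Lemma sqrt_bound (R : realType) (m c q : nat) :
  (0 < m)%N -> (m <= 4 * c)%N -> (m <= 4 * q)%N ->
  64^-1 * (m%:R ^+ 2 * Num.sqrt m%:R) / m%:R < (q * c)%:R / 2 :> R.
Proof.
move=> m_gt0 m4c m4q; have mR_gt0 : 0 < m%:R :> R by rewrite ltr0n.
have sqrt_le : Num.sqrt m%:R <= m%:R :> R.
  rewrite -(ler_pXn2r (ltn0Sn 1)) ?nnegrE ?sqrtr_ge0 ?ler0n //.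
  by rewrite sqr_sqrtr ?ler0n // -natrX ler_nat expnS leq_pmulr.
have m2_le : m%:R * m%:R <= 16 * (q * c)%:R :> R.
  by rewrite -!natrM ler_nat; nia.
have -> : 64^-1 * (m%:R ^+ 2 * Num.sqrt m%:R) / m%:R =
    64^-1 * (m%:R * Num.sqrt m%:R) :> R by field; rewrite gt_eqF.
have := ler_wpM2l (ltW mR_gt0) sqrt_le.
have : 0 < m%:R * m%:R :> R by rewrite mulr_gt0.
by lra.
Qed.

Theorem mainTheorem4 (R : realType) (f : voting_rule) :
  (* utilitarian distortion is o(m^2 sqrt m) *)
  (forall eps : R, 0 < eps -> exists M : nat, forall m : nat, (M <= m)%N ->
     (utilitarian_distortion R f m
        <= (eps * (m%:R ^+ 2 * Num.sqrt (m%:R)))%:E)%E) ->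
  exists M : nat, forall m : nat, (M <= m)%N ->
    (3%:E < metric_distortion R f m)%E.
Proof.
(* The value 1 / 64 is the constant of [sqrt_bound]; m >= 8 ensures that halving m - 2 leaves both
   [c] and [q] at least m / 4. *)
move=> small; have [|M smallM] := small (64%:R^-1); first by rewrite invr_gt0.
exists (maxn M 8) => m; rewrite geq_max => /andP[/smallM + m_ge8].
pose c := (m - 2)./2; pose q := (m - 2 - c)%N.
have m4c : (m <= 4 * c)%N by rewrite /c; lia.
have m4q : (m <= 4 * q)%N by rewrite /q /c; lia.
have mE : m = (c.+1 + q).+1 by rewrite /q /c; lia.
clearbody c q; subst m; rewrite /utilitarian_distortion /metric_distortion.
set m := (c.+1 + q).+1 in m_ge8 m4c m4q *; set C := _ * _ => leC.
case: (unliftP ord0 (f _ _ (hard_profile c q))) => [z|f0]; last first.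
  by have := lt_le_trans (zero_winner_distortion R f c q C f0) leC; rewrite ltxx.
rewrite -[z]fintype.splitK; case: (fintype.split z) => [y|x] fz.
  have C_lt := sqrt_bound R m c q isT m4c m4q.
  have := lt_le_trans (low_winner_distortion R f c q y C fz C_lt) leC.
  by rewrite ltxx.
exact: high_winner_distortion fz.
Qed.
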